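(* (1) The assignment $X \mapsto \mathsf{C}(X)$, $f \mapsto \mathsf{C}(f)$ with $\mathsf{C}(f)(A) = f(A)^{\perp\perp}$, is a faithful, dagger essentially surjective, dagger-preserving functor from $\mathcal{iDS}$ to $\mathcal{cOML}$. (2) If $X$ is an irredundant orthoset such that for every subspace $A$ of $X$ the inclusion map $A \to X$ is adjointable (i.e. a morphism of $\mathcal{iOS}$), then $X$ is an object of $\mathcal{iDS}$. Moreover, every complete orthomodular lattice is, up to isomorphism of ortholattices, of the form $\mathsf{C}(X)$ for such an orthoset $X$.
   Context: An orthoset (with $0$) is a non-empty set $X$ with a binary relation $\perp$ and element $0$ such that: $\perp$ is symmetric; $x \perp x$ iff $x=0$; $0 \perp x$ for all $x$. For $A \subseteq X$, $A^\perp = \{x : x \perp y\ \forall y \in A\}$; subspaces are the sets $A=A^{\perp\perp}$ (they contain $0$ and, with the restricted relation, are orthosets); $\mathsf{C}(X)$ is the complete ortholattice of subspaces. $X$ is irredundant if for nonzero $x,y$, $\{x\}^\perp=\{y\}^\perp$ implies $x=y$; $X$ is a Dacey space if $\mathsf{C}(X)$ is orthomodular. A map $f\colon X\to Y$ is adjointable if there is $g\colon Y\to X$ with $f(x)\perp y\iff x\perp g(y)$; between irredundant orthosets it is unique, written $f^\star$. $\mathcal{iOS}$ is the dagger category of irredundant orthosets and adjointable maps with dagger $f\mapsto f^\star$; $\mathcal{iDS}$ is its full dagger subcategory of irredundant Dacey spaces. A complete ortholattice $L$ is regarded as an orthoset with $a\perp b$ iff $a\le b^\perp$ and $0$ the bottom;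 $\mathcal{cOML}$ is the dagger category of complete orthomodular lattices with the adjointable maps as morphisms and the unique adjoint as dagger. A dagger isomorphism is $u$ with $u^\star u=\mathrm{id}$, $uu^\star=\mathrm{id}$; a functor is dagger-preserving if $F(f^\star)=F(f)^\star$ and dagger essentially surjective if each target object is dagger isomorphic to some $F(X)$. *)

(* Defs.v *)
From HB Require Import structures.
From mathcomp Require Import all_boot all_order.
From mathcomp Require Import boolp classical_sets.

Set Implicit Arguments.
Unset Strict Implicit.
Unset Printing Implicit Defensive.

Import Order.TTheory SetOrder.Exports.

Local Open Scope classical_set_scope.

HB.mixin Record isOrthoset (X : Type) := {
  orth : X -> X -> Prop;
  orth0 : X;
  orth_sym : forall x y, orth x y -> orth y x;
  orth_refl : forall x, orth x x <-> x = orth0;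
  orth0l : forall x, orth orth0 x
}.

#[short(type="orthosetType")]
HB.structure Definition Orthoset := { X of isOrthoset X }.

Arguments orth0 {s}.
Notation "x '_|_' y" := (orth x y) (at level 70, no associativity).

Definition perp (X : orthosetType) (A : set X) : set X :=
  [set x | forall y, A y -> x _|_ y].

Definition biperp (X : orthosetType) (A : set X) : set X := perp (perp A).

Definition irredundant (X : orthosetType) : Prop :=
  forall x y : X, x <> orth0 -> y <> orth0 ->
    perp [set x] = perp [set y] -> x = y.

Definition adjoint (X Y : orthosetType) (f : X -> Y) (g : Y -> X) : Prop :=
  forall x y, f x _|_ y <-> x _|_ g y.

Definition adjointable (X Y : orthosetType) (f : X -> Y) : Prop :=
  exists g : Y -> X, adjoint f g.

Section OrthosetTheory.
Context {X : orthosetType}.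
Implicit Types (x y : X) (A B : set X).

Lemma orthC x y : x _|_ y <-> y _|_ x.
Proof. by split; apply: orth_sym. Qed.

Lemma orth0r x : x _|_ orth0.
Proof. exact/orth_sym/orth0l. Qed.

Lemma perp_anti A B : A `<=` B -> perp B `<=` perp A.
Proof. by move=> AB x Bx y /AB; apply: Bx. Qed.

Lemma sub_biperp A : A `<=` biperp A.
Proof. by move=> x Ax y; move/(_ _ Ax)/orth_sym. Qed.

Lemma perp3 A : perp (biperp A) = perp A.
Proof.
apply/seteqP; split; last exact: sub_biperp.
exact/perp_anti/sub_biperp.
Qed.

Lemma biperp_mono A B : A `<=` B -> biperp A `<=` biperp B.
Proof. by move=> AB; exact/perp_anti/perp_anti. Qed.

Lemma perp_has0 A : perp A orth0.
Proof. by move=> y _; apply: orth0l. Qed.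

Lemma perp_inj x y : irredundant X -> (forall z, x _|_ z <-> y _|_ z) -> x = y.
Proof.
move=> irrX xy.
have [x0|x0] := pselect (x = orth0).
  by rewrite x0; apply/esym/orth_refl/xy; rewrite x0; apply: orth0l.
have [y0|y0] := pselect (y = orth0).
  by rewrite y0; apply/orth_refl/xy; rewrite y0; apply: orth0l.
apply: irrX => //; apply/seteqP; split => z zx _ ->; apply/orth_sym/xy.
  exact/orth_sym/zx.
exact/orth_sym/zx.
Qed.

End OrthosetTheory.

Lemma adjoint_sym (X Y : orthosetType) (f : X -> Y) (g : Y -> X) :
  adjoint f g -> adjoint g f.
Proof. by move=> fg y x; rewrite orthC -fg orthC. Qed.

Lemma adjoint_uniq (X Y : orthosetType) (f : X -> Y) (g h : Y -> X) :
  irredundant X -> adjoint f g -> adjoint f h -> g = h.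
Proof.
move=> irrX fg fh; apply/funext => y; apply: perp_inj => // x.
by rewrite orthC -fg fh orthC.
Qed.

HB.mixin Record TBLattice_isOrtholattice d (L : Type) of Order.TBLattice d L := {
  ortho : L -> L;
  orthoK : involutive ortho;
  ortho_anti : forall a b : L, (a <= b)%O -> (ortho b <= ortho a)%O;
  meet_ortho : forall a : L, (a `&` ortho a)%O = \bot%O;
  join_ortho : forall a : L, (a `|` ortho a)%O = \top%O
}.

#[short(type="ortholatticeType")]
HB.structure Definition Ortholattice d :=
  { L of Order.TBLattice d L & TBLattice_isOrtholattice d L }.

HB.mixin Record Lattice_isComplete d (L : Type) of Order.Lattice d L := {
  ex_supremum : forall S : set L, supremums S !=set0;
  ex_infimum : forall S : set L, infimums S !=set0
}.

#[short(type="completeOrtholatticeType")]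
HB.structure Definition CompleteOrtholattice d :=
  { L of Ortholattice d L & Lattice_isComplete d L }.

Definition orthomodular d (L : ortholatticeType d) : Prop :=
  forall a b : L, (a <= b)%O -> b = (a `|` (b `&` ortho a))%O.

Definition ortholattice_iso d d' (L : ortholatticeType d)
    (M : ortholatticeType d') (phi : L -> M) : Prop :=
  [/\ bijective phi,
      Order.meet_morphism phi,
      Order.join_morphism phi,
      phi \bot%O = \bot%O /\ phi \top%O = \top%O
    & {morph phi : a / ortho a}].

Definition subspaces (X : orthosetType) : Type :=
  {A : set X | `[< A = biperp A >]}.

Section Subspaces.
Context {X : orthosetType}.

HB.instance Definition _ := SubType.on (subspaces X).
HB.instance Definition _ := [Choice of subspaces X by <:].
HB.instance Definition _ :=
  [SubChoice_isSubPOrder of subspaces X by <: with set_display].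

Implicit Types A B C : subspaces X.

Lemma subspaceK A : biperp (val A) = val A.
Proof. by have /asboolP/esym := valP A. Qed.

Lemma subspace_le A B : (A <= B)%O <-> val A `<=` val B.
Proof. by rewrite leEsub; split => /subsetPset. Qed.

Lemma subspace_has0 A : val A orth0.
Proof. by rewrite -subspaceK; apply: perp_has0. Qed.

Lemma perp_subspace_proof (S : set X) : `[< perp S = biperp (perp S) >].
Proof. exact/asboolP/esym/perp3. Qed.

Definition perp_subspace (S : set X) : subspaces X :=
  exist _ (perp S) (perp_subspace_proof S).

Definition span (S : set X) : subspaces X := perp_subspace (perp S).

Lemma span_le (S : set X) A : (span S <= A)%O <-> S `<=` val A.
Proof.
rewrite subspace_le; split=> SA; first by apply: subset_trans SA; apply: sub_biperp.
by rewrite -(subspaceK A); apply: biperp_mono.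
Qed.

Lemma biperp_setI A B : `[< val A `&` val B = biperp (val A `&` val B) >].
Proof.
apply/asboolP/seteqP; split; first exact: sub_biperp.
rewrite subsetI; split.
  by rewrite -[X in _ `<=` X](subspaceK A); apply: biperp_mono; apply: subIsetl.
by rewrite -[X in _ `<=` X](subspaceK B); apply: biperp_mono; apply: subIsetr.
Qed.

Definition subspace_meet A B : subspaces X :=
  exist _ (val A `&` val B) (biperp_setI A B).
Definition subspace_join A B : subspaces X := span (val A `|` val B).
Definition subspace_bot : subspaces X := perp_subspace setT.
Definition subspace_top : subspaces X := perp_subspace set0.

Fact subspace_meetP A B C :
  (A <= subspace_meet B C)%O = (A <= B)%O && (A <= C)%O.
Proof.
apply/idP/andP => [/subspace_le|[/subspace_le ? /subspace_le ?]].
  by rewrite subsetI => -[? ?]; split; apply/subspace_le.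
by apply/subspace_le; rewrite subsetI.
Qed.

Fact subspace_joinP A B C :
  (subspace_join A B <= C)%O = (A <= C)%O && (B <= C)%O.
Proof.
apply/idP/andP => [/span_le|[/subspace_le ? /subspace_le ?]].
  by rewrite subUset => -[? ?]; split; apply/subspace_le.
by apply/span_le; rewrite subUset.
Qed.

Fact subspace_bot_le A : (subspace_bot <= A)%O.
Proof.
apply/subspace_le => x /(_ x I)/orth_refl ->; exact: subspace_has0.
Qed.

Fact subspace_le_top A : (A <= subspace_top)%O.
Proof. by apply/subspace_le => x _ y. Qed.

HB.instance Definition _ := Order.POrder_MeetJoin_isLattice.Build set_display
  (subspaces X) subspace_meetP subspace_joinP.
HB.instance Definition _ := Order.hasBottom.Build set_display
  (subspaces X) subspace_bot_le.
HB.instance Definition _ := Order.hasTop.Build set_display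
  (subspaces X) subspace_le_top.

Definition subspace_ortho A : subspaces X := perp_subspace (val A).

Fact subspace_orthoK : involutive subspace_ortho.
Proof. by move=> A; apply/val_inj; apply: subspaceK. Qed.

Fact subspace_ortho_anti A B :
  (A <= B)%O -> (subspace_ortho B <= subspace_ortho A)%O.
Proof. by move/subspace_le => AB; apply/subspace_le/perp_anti. Qed.

Fact subspace_meet_ortho A : (A `&` subspace_ortho A)%O = \bot%O.
Proof.
apply/le_anti; rewrite le0x andbT.
by apply/subspace_le => x [Ax /(_ x Ax)/orth_refl ->]; apply: subspace_has0.
Qed.

Fact subspace_join_ortho A : (A `|` subspace_ortho A)%O = \top%O.
Proof.
have ortho_bot : subspace_ortho \bot%O = \top%O.
  apply/le_anti; rewrite lex1 /= -[\top%O]subspace_orthoK.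
  exact/subspace_ortho_anti/le0x.
rewrite -ortho_bot -[LHS]subspace_orthoK; congr subspace_ortho.
apply/le_anti; rewrite le0x andbT -(subspace_meet_ortho A) lexI.
apply/andP; split.
  rewrite -[X in (_ <= X)%O]subspace_orthoK.
  exact/subspace_ortho_anti/leUr.
exact/subspace_ortho_anti/leUl.
Qed.

HB.instance Definition _ := TBLattice_isOrtholattice.Build set_display
  (subspaces X) subspace_orthoK subspace_ortho_anti
  subspace_meet_ortho subspace_join_ortho.

Fact subspace_ex_supremum (S : set (subspaces X)) : supremums S !=set0.
Proof.
exists (span (\bigcup_(A in S) val A)); split => [A SA|B SB].
  apply/subspace_le; apply: subset_trans (@sub_biperp X _).
  by move=> x Ax; exists A.
by apply/span_le; apply: bigcup_sub => A /SB/subspace_le.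
Qed.

Fact subspace_ex_infimum (S : set (subspaces X)) : infimums S !=set0.
Proof.
have [B [ubB lubB]] := subspace_ex_supremum (lbound S).
exists B; split => [A SA|C]; last exact: ubB.
by apply: lubB => C; apply.
Qed.

HB.instance Definition _ := Lattice_isComplete.Build set_display
  (subspaces X) subspace_ex_supremum subspace_ex_infimum.

End Subspaces.

Definition dacey (X : orthosetType) : Prop := orthomodular (subspaces X).

Definition subspace_sort (X : orthosetType) (A : subspaces X) : Type :=
  {x : X | val A x}.

Section SubspaceOrthoset.
Context {X : orthosetType} {A : subspaces X}.

Definition incl (a : subspace_sort A) : X := sval a.

Definition sub_orth (a b : subspace_sort A) : Prop := incl a _|_ incl b.
Definition sub0 : subspace_sort A := exist _ orth0 (subspace_has0 A).

Fact sub_orth_sym a b : sub_orth a b -> sub_orth b a.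
Proof. exact: orth_sym. Qed.

Fact sub_orth_refl a : sub_orth a a <-> a = sub0.
Proof.
split=> [/orth_refl a0|->]; last exact: orth0l.
by case: a a0 => x Ax /= x0; apply: eq_exist.
Qed.

Fact sub_orth0l a : sub_orth sub0 a.
Proof. exact: orth0l. Qed.

HB.instance Definition _ := isOrthoset.Build (subspace_sort A)
  sub_orth_sym sub_orth_refl sub_orth0l.

End SubspaceOrthoset.

Arguments incl {X} A _.

(** An adjointable inclusion into an irredundant orthoset is thus a morphism
    of irredundant orthosets. *)
Lemma adjointable_incl_irredundant (X : orthosetType) (A : subspaces X) :
  irredundant X -> adjointable (incl A) ->
  irredundant (subspace_sort A : orthosetType).
Proof.
move=> irrX [g ag] a b _ _ /seteqP[ab ba].
have h (c e : subspace_sort A) : perp [set c] `<=` perp [set e] ->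
    forall z, incl A c _|_ z -> incl A e _|_ z.
  move=> ce z /ag cz; apply/ag/orth_sym; apply: ce => // _ ->.
  exact: orth_sym.
have : incl A a = incl A b.
  by apply: perp_inj => // z; split; apply: h.
by case: a b {ab ba} => [x Ax] [y Ay] /= xy; apply: eq_exist.
Qed.

Definition orthoset_of d (L : ortholatticeType d) : Type := L.

Section OrtholatticeOrthoset.
Context {d : Order.disp_t} {L : ortholatticeType d}.
Implicit Types a b : orthoset_of L.

Definition lat_orth (a b : orthoset_of L) : Prop := ((a : L) <= ortho (b : L))%O.

Fact lat_orth_sym a b : lat_orth a b -> lat_orth b a.
Proof. by rewrite /lat_orth => /ortho_anti; rewrite orthoK. Qed.

Fact lat_orth_refl a : lat_orth a a <-> a = (\bot%O : L).
Proof.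
split=> [|->]; last exact: le0x.
by move/meet_l => aa; rewrite -[LHS]aa meet_ortho.
Qed.

Fact lat_orth0l a : lat_orth (\bot%O : L) a.
Proof. exact: le0x. Qed.

HB.instance Definition _ := isOrthoset.Build (orthoset_of L)
  lat_orth_sym lat_orth_refl lat_orth0l.

Lemma irredundant_orthoset_of : irredundant (orthoset_of L : orthosetType).
Proof.
move=> a b _ _ /seteqP[ab ba].
have h (x y : L) : perp [set (x : orthoset_of L)] `<=` perp [set y : orthoset_of L] ->
    (y <= x)%O.
  move=> /(_ (ortho x)) xy; rewrite -[x]orthoK -[y]orthoK.
  apply: ortho_anti; apply: xy => // z ->; exact: lexx.
by apply/(@le_anti _ L); rewrite (h _ _ ab) (h _ _ ba).
Qed.

End OrtholatticeOrthoset.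

Record daggerCat := DaggerCat {
  obj :> Type;
  hom : obj -> obj -> Type;
  idm : forall X, hom X X;
  comp : forall X Y Z, hom Y Z -> hom X Y -> hom X Z;
  dagger : forall X Y, hom X Y -> hom Y X;
  comp1m : forall X Y (f : hom X Y), comp (idm Y) f = f;
  compm1 : forall X Y (f : hom X Y), comp f (idm X) = f;
  compA : forall W X Y Z (h : hom Y Z) (g : hom X Y) (f : hom W X),
    comp h (comp g f) = comp (comp h g) f;
  dagger1 : forall X, dagger (idm X) = idm X;
  dagger_comp : forall X Y Z (g : hom Y Z) (f : hom X Y),
    dagger (comp g f) = comp (dagger f) (dagger g);
  daggerK : forall X Y (f : hom X Y), dagger (dagger f) = f
}.

Arguments hom {d} X Y.
Arguments idm {d} X.
Arguments comp {d X Y Z} g f.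
Arguments dagger {d X Y} f.

Definition dagger_iso (C : daggerCat) (X Y : C) (u : hom X Y) : Prop :=
  comp (dagger u) u = idm X /\ comp u (dagger u) = idm Y.

(** Functors with prescribed object part [F0]; an inhabitant is the morphism
    part together with functoriality. *)
Record functor_on (C D : daggerCat) (F0 : C -> D) := FunctorOn {
  fmap : forall X Y : C, hom X Y -> hom (F0 X) (F0 Y);
  fmap1 : forall X, fmap (idm X) = idm (F0 X);
  fmap_comp : forall X Y Z (g : hom Y Z) (f : hom X Y),
    fmap (comp g f) = comp (fmap g) (fmap f)
}.

Arguments fmap {C D F0} F {X Y} f : rename.

Definition faithful (C D : daggerCat) (F0 : C -> D) (F : functor_on F0) : Prop :=
  forall X Y : C, injective (@fmap C D F0 F X Y).

Definition dagger_preserving (C D : daggerCat) (F0 : C -> D)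
    (F : functor_on F0) : Prop :=
  forall (X Y : C) (f : hom X Y), fmap F (dagger f) = dagger (fmap F f).

Definition dagger_essentially_surjective (C D : daggerCat) (F0 : C -> D)
    (F : functor_on F0) : Prop :=
  forall Y : D, exists (X : C) (u : hom (F0 X) Y), dagger_iso u.

(** The dagger category with objects [T] and the morphisms of [C]; a full
    dagger subcategory when [o] is a subtype projection. *)
Definition full_dagger (C : daggerCat) (T : Type) (o : T -> C) : daggerCat :=
  @DaggerCat T (fun X Y => hom (o X) (o Y)) (fun X => idm (o X))
    (fun X Y Z => @comp C (o X) (o Y) (o Z))
    (fun X Y => @dagger C (o X) (o Y))
    (fun X Y => @comp1m C (o X) (o Y))
    (fun X Y => @compm1 C (o X) (o Y))
    (fun W X Y Z => @compA C (o W) (o X) (o Y) (o Z))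
    (fun X => @dagger1 C (o X))
    (fun X Y Z => @dagger_comp C (o X) (o Y) (o Z))
    (fun X Y => @daggerK C (o X) (o Y)).

Record adjMap (X Y : orthosetType) := AdjMap {
  adj_fun :> X -> Y;
  adj_funP : adjointable adj_fun
}.

Lemma adjMap_eq (X Y : orthosetType) (f g : adjMap X Y) : f =1 g -> f = g.
Proof.
case: f g => [f fP] [g gP] /= /funext fg; rewrite fg in fP *.
by congr AdjMap; apply: Prop_irrelevance.
Qed.

Lemma adjoint_id (X : orthosetType) : @adjoint X X id id.
Proof. by []. Qed.

Lemma adjoint_comp (X Y Z : orthosetType) (g : Y -> Z) (g' : Z -> Y)
    (f : X -> Y) (f' : Y -> X) :
  adjoint g g' -> adjoint f f' -> adjoint (g \o f) (f' \o g').
Proof. by move=> gg ff x z; rewrite /= gg ff. Qed.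

(** The adjoint is unique only between irredundant orthosets ([star_uniq]);
    in general this is an arbitrary choice of one. *)
Definition star_fun (X Y : orthosetType) (f : adjMap X Y) : Y -> X :=
  sval (cid (adj_funP f)).

Lemma star_funP (X Y : orthosetType) (f : adjMap X Y) : adjoint f (star_fun f).
Proof. exact: (svalP (cid (adj_funP f))). Qed.

Definition adj_id (X : orthosetType) : adjMap X X :=
  AdjMap (ex_intro _ id (@adjoint_id X)).

Definition adj_comp (X Y Z : orthosetType) (g : adjMap Y Z) (f : adjMap X Y) :
    adjMap X Z :=
  AdjMap (ex_intro _ _ (adjoint_comp (star_funP g) (star_funP f))).

Definition star (X Y : orthosetType) (f : adjMap X Y) : adjMap Y X :=
  AdjMap (ex_intro _ _ (adjoint_sym (star_funP f))).

Lemma star_uniq (X Y : orthosetType) (f : adjMap X Y) (g : adjMap Y X) :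
  irredundant X -> adjoint f g -> star f = g.
Proof.
move=> irrX fg; apply: adjMap_eq => y.
by rewrite /= (adjoint_uniq irrX (star_funP f) fg).
Qed.

Record iOrthoset := IOrthoset {
  iorthoset_sort :> orthosetType;
  iorthosetP : irredundant iorthoset_sort
}.

Section OrthosetCategory.
Implicit Types W X Y Z : iOrthoset.

Fact adj_comp1m X Y (f : adjMap X Y) : adj_comp (adj_id Y) f = f.
Proof. exact: adjMap_eq. Qed.

Fact adj_compm1 X Y (f : adjMap X Y) : adj_comp f (adj_id X) = f.
Proof. exact: adjMap_eq. Qed.

Fact adj_compA W X Y Z (h : adjMap Y Z) (g : adjMap X Y) (f : adjMap W X) :
  adj_comp h (adj_comp g f) = adj_comp (adj_comp h g) f.
Proof. exact: adjMap_eq. Qed.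

Fact star_id X : star (adj_id X) = adj_id X.
Proof. by apply: star_uniq; [exact: iorthosetP | exact: adjoint_id]. Qed.

Fact star_comp X Y Z (g : adjMap Y Z) (f : adjMap X Y) :
  star (adj_comp g f) = adj_comp (star f) (star g).
Proof.
apply: star_uniq; first exact: iorthosetP.
by apply: adjoint_comp; apply: star_funP.
Qed.

Fact starK X Y (f : adjMap X Y) : star (star f) = f.
Proof.
apply: star_uniq; first exact: iorthosetP.
exact/adjoint_sym/star_funP.
Qed.

End OrthosetCategory.

Definition iOS : daggerCat := @DaggerCat iOrthoset
  (fun X Y => adjMap X Y) (fun X => adj_id X)
  (fun X Y Z => @adj_comp X Y Z) (fun X Y => @star X Y)
  adj_comp1m adj_compm1 adj_compA star_id star_comp starK.

Record iDacey := IDacey {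
  idacey_sort :> iOrthoset;
  idaceyP : dacey idacey_sort
}.

Definition iDS : daggerCat := @full_dagger iOS iDacey idacey_sort.

(** The order display is a notational parameter, so objects range over all
    displays. *)
Record completeOML := CompleteOML {
  coml_disp : Order.disp_t;
  coml_sort :> completeOrtholatticeType coml_disp;
  comlP : orthomodular coml_sort
}.

Definition coml_orthoset (L : completeOML) : iOrthoset :=
  @IOrthoset (orthoset_of L) irredundant_orthoset_of.

Definition cOML : daggerCat := @full_dagger iOS completeOML coml_orthoset.

Definition subspaces_coml (X : iDS) : cOML :=
  @CompleteOML set_display (subspaces (X : iDacey)) (@idaceyP X).

(* Main.v *)
(** For (1), [C(f)] has adjoint [C(f^star)] because [f(A) _|_ B] iff
    [A _|_ f^star(B)], and [f] is recovered from its values on the subspaces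
    generated by single points. A complete orthomodular lattice [L], seen as an
    orthoset, has exactly the principal ideals as subspaces, so
    [C(L)] is [L]; the inclusion of the ideal of [a] is adjoint to the Sasaki
    projection [x |-> a /\ (a^perp \/ x)].

    For (2), if [p] is adjoint to the inclusion of [A] and [G <= A], then
    [G] is the orthocomplement relative to [A] of [p(G^perp)]. Hence [G] is
    closed in [A], that is, [G = A /\ (A /\ G^perp)^perp], which is the dual
    form of orthomodularity. *)

Require Import Defs.
From HB Require Import structures.
From mathcomp Require Import all_boot all_order.
From mathcomp Require Import boolp classical_sets.

Set Implicit Arguments.
Unset Strict Implicit.
Unset Printing Implicit Defensive.

Import Order.TTheory SetOrder.Exports.

Local Open Scope classical_set_scope.

(** * Functoriality of C on adjointable maps *)

(** If [g] is adjoint to [f], then [y] is orthogonal to f(S) iff [g y] lies in S^perp, and S^perp is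
    unchanged when S is closed. Compatibility with composition and faithfulness both rest on
    this. *)
Lemma biperp_image_biperp (X Y : orthosetType) (f : X -> Y) (S : set X) :
  adjointable f -> biperp (f @` biperp S) = biperp (f @` S).
Proof.
move=> [g fg]; congr perp; apply/seteqP; split.
  by apply/perp_anti/image_subset/sub_biperp.
move=> y yS _ [x xS <-]; apply/orth_sym/fg; apply: xS => s Ss.
by apply/orth_sym/fg/orth_sym/yS; exists s.
Qed.

(** Typed on [orthoset_of] so that [adjoint] refers to the lattice orthogonality of subspaces. *)
Definition span_map (X Y : orthosetType) (f : X -> Y) (A : orthoset_of (subspaces X)) :
  orthoset_of (subspaces Y) := span (f @` val A).

Lemma adjoint_span_map (X Y : orthosetType) (f : X -> Y) (g : Y -> X) :
  adjoint f g -> adjoint (span_map f) (span_map g).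
Proof.
move=> fg A B; split.
  move/span_le => fAB; apply/subspace_le => x Ax.
  rewrite /= perp3 => _ [y By <-]; apply/fg.
  by apply: fAB y By; exists x.
move/subspace_le => AgB; apply/span_le => _ [x Ax <-] y By; apply/fg.
by have /= := AgB x Ax; rewrite perp3; apply; exists y.
Qed.

Definition adj_span (X Y : orthosetType) (f : adjMap X Y) :
    adjMap (orthoset_of (subspaces X)) (orthoset_of (subspaces Y)) :=
  AdjMap (ex_intro _ _ (adjoint_span_map (star_funP f))).

Lemma adj_span_inj (X Y : orthosetType) :
  irredundant Y -> injective (@adj_span X Y).
Proof.
move=> irrY f g /(congr1 (@adj_fun _ _)) fg; apply: adjMap_eq => x.
apply: perp_inj => // z.
have : biperp (f @` biperp [set x]) = biperp (g @` biperp [set x]).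
  exact: (congr1 (fun h => val (h (span [set x]) : subspaces Y)) fg).
(* Both sides reduce to the closures of [f x] and [g x], which therefore have the same
   orthocomplement. *)
rewrite !(biperp_image_biperp _ (adj_funP _)) !image_set1.
move/(congr1 (@perp Y)); rewrite !perp3 => /seteqP[h1 h2].
split=> /orth_sym zx; apply/orth_sym.
  by apply: h1 => // _ ->.
by apply: h2 => // _ ->.
Qed.

Lemma adj_span1 (X : orthosetType) : adj_span (adj_id X) = adj_id _.
Proof.
apply: adjMap_eq => A; apply: val_inj; rewrite /= image_id.
exact: subspaceK.
Qed.

Lemma adj_span_comp (X Y Z : orthosetType) (g : adjMap Y Z) (f : adjMap X Y) :
  adj_span (adj_comp g f) = adj_comp (adj_span g) (adj_span f).
Proof.
apply: adjMap_eq => A; apply: val_inj; rewrite /= -(image_comp f g).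
exact: esym (biperp_image_biperp (f @` val (A : subspaces X)) (adj_funP g)).
Qed.

Definition subspaces_functor : functor_on subspaces_coml :=
  @FunctorOn iDS cOML subspaces_coml
    (fun X Y (f : adjMap (X : iDacey) (Y : iDacey)) => adj_span f)
    (fun X => adj_span1 (X : iDacey))
    (fun X Y Z (g : adjMap (Y : iDacey) (Z : iDacey)) f => adj_span_comp g f).

Lemma star_adj_span (X Y : orthosetType) (f : adjMap X Y) :
  adj_span (star f) = star (adj_span f).
Proof.
apply/esym/star_uniq; first exact: irredundant_orthoset_of.
exact/adjoint_span_map/star_funP.
Qed.

(** * De Morgan laws and dual orthomodularity *)

Lemma ortho_inj d (L : ortholatticeType d) : injective (@ortho d L).
Proof. exact: can_inj (@orthoK d L). Qed.

Lemma ortho_le d (L : ortholatticeType d) (a b : L) :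
  (ortho a <= ortho b)%O = (b <= a)%O.
Proof.
by apply/idP/idP => /ortho_anti //; rewrite !orthoK.
Qed.

Lemma le_orthoC d (L : ortholatticeType d) (a b : L) :
  (a <= ortho b)%O = (b <= ortho a)%O.
Proof. by rewrite -ortho_le orthoK. Qed.

Lemma ortho_join d (L : ortholatticeType d) (a b : L) :
  ortho (a `|` b)%O = (ortho a `&` ortho b)%O.
Proof.
apply/le_anti; rewrite lexI !ortho_le leUl leUr /=.
by rewrite le_orthoC leUx (le_orthoC a) (le_orthoC b) leIl leIr.
Qed.

Lemma ortho_meet d (L : ortholatticeType d) (a b : L) :
  ortho (a `&` b)%O = (ortho a `|` ortho b)%O.
Proof. by rewrite -[RHS]orthoK ortho_join !orthoK. Qed.

(** Each law is the other one applied to [ortho b <= ortho a], up to De Morgan. *)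
Lemma orthomodular_dual d (L : ortholatticeType d) :
  orthomodular L <->
  forall a b : L, (a <= b)%O -> a = (b `&` (ortho b `|` a))%O.
Proof.
split=> om a b ab; apply: ortho_inj.
  rewrite ortho_meet ortho_join orthoK (meetC b).
  by rewrite {1}(om (ortho b) (ortho a)) ?orthoK ?ortho_le.
rewrite ortho_join ortho_meet orthoK (joinC (ortho b)).
by rewrite {1}(om (ortho b) (ortho a)) ?orthoK ?ortho_le.
Qed.

(** * From adjointable inclusions to orthomodularity *)

Lemma adjointable_incl_dacey (X : orthosetType) :
  (forall A : subspaces X, adjointable (incl A)) -> dacey X.
Proof.
move=> adjX; apply/orthomodular_dual => G A GA.
apply/le_anti; rewrite lexI GA leUr /=; have [p ip] := adjX A.
apply/subspace_le => x [Ax xG]; rewrite -subspaceK => z zG.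
(* It suffices that [p z] is orthogonal to A^perp and to G: the former because [p z] lies in A, the
   latter because [z] is orthogonal to G. *)
apply/(ip (exist _ x Ax)); apply: xG => w [wA|wG].
  by apply/orth_sym/wA; apply: (svalP (p z)).
have Aw : val A w by move/subspace_le: GA; apply.
exact/orth_sym/(proj1 (ip (exist _ w Aw) z))/orth_sym/zG.
Qed.

(** * Subspaces of a complete ortholattice as principal ideals *)

Section PrincipalIdeals.
Context {d : Order.disp_t} {L : completeOrtholatticeType d}.
Implicit Types a b : L.

Notation X := (orthoset_of L : orthosetType).

Definition sup (S : set L) : L := sval (cid (ex_supremum S)).

Lemma sup_le (S : set L) b : (sup S <= b)%O <-> forall x, S x -> (x <= b)%O.
Proof.
rewrite /sup; case: cid => s /= [ubs lubs]; split=> [sb x /ubs xs|Sb].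
  exact: le_trans xs sb.
exact: lubs.
Qed.

(** Written as an orthocomplement, the principal ideal is a subspace by construction. *)
Definition ideal a : subspaces X := perp_subspace [set (ortho a : X)].

Lemma idealE a b : val (ideal a) b <-> (b <= a)%O.
Proof.
split=> [/(_ _ erefl) ba|ba _ ->]; first by rewrite -[a]orthoK.
by change (b <= ortho (ortho a))%O; rewrite orthoK.
Qed.

Lemma perp_sup (S : set X) b : perp S b <-> (b <= ortho (sup S))%O.
Proof.
rewrite le_orthoC sup_le.
by split=> Sb x /Sb; [exact: lat_orth_sym | exact: (@lat_orth_sym _ _ x)].
Qed.

(** Anything below the supremum of A is orthogonal to all of A^perp, hence lies in A^perp^perp =
    A. *)
Lemma subspace_supE (A : subspaces X) b : val A b <-> (b <= sup (val A))%O.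
Proof.
split=> [Ab|bA]; first by move: b Ab; apply/sup_le.
rewrite -subspaceK => y /perp_sup yA.
by apply: (@le_trans _ L _ _ _ bA); rewrite le_orthoC.
Qed.

Lemma ideal_le a b : (ideal a <= ideal b)%O = (a <= b)%O.
Proof.
apply/idP/idP => [/subspace_le ab|ab].
  by apply/idealE/ab/idealE; exact: lexx.
by apply/subspace_le => x /idealE xa; apply/idealE/(le_trans xa).
Qed.

Definition subspace_sup (A : subspaces X) : L := sup (val A).

Lemma subspace_supK : cancel subspace_sup ideal.
Proof.
move=> A; apply/val_inj/seteqP; split=> x.
  by move/idealE/subspace_supE.
by move/subspace_supE/idealE.
Qed.

Lemma idealK : cancel ideal subspace_sup.
Proof.
move=> a; apply/le_anti/andP; split; last by apply/subspace_supE/idealE/lexx.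
by apply/sup_le => x /idealE.
Qed.

Lemma subspace_sup_le (A B : subspaces X) :
  (subspace_sup A <= subspace_sup B)%O = (A <= B)%O.
Proof. by rewrite -ideal_le !subspace_supK. Qed.

Lemma ortho_ideal a : ortho (ideal a) = ideal (ortho a).
Proof.
apply/val_inj/seteqP; split=> x.
  by move/perp_sup; rewrite -/(subspace_sup _) idealK => /idealE.
by move/idealE => xa; apply/perp_sup; rewrite -/(subspace_sup _) idealK.
Qed.

Lemma subspace_sup_iso : ortholattice_iso subspace_sup.
Proof.
have leP (A : subspaces X) b : (subspace_sup A <= b)%O = (A <= ideal b)%O.
  by rewrite -ideal_le subspace_supK.
have geP (A : subspaces X) b : (b <= subspace_sup A)%O = (ideal b <= A)%O.
  by rewrite -ideal_le subspace_supK.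
split.
- by exists ideal; [exact: subspace_supK | exact: idealK].
- move=> A B; apply/le_anti; rewrite lexI !subspace_sup_le leIl leIr /=.
  by rewrite geP lexI -!geP leIl leIr.
- move=> A B; apply/le_anti; rewrite leUx !subspace_sup_le leUl leUr !andbT.
  by rewrite leP leUx -!leP leUl leUr.
- by split; apply/le_anti; rewrite ?le0x ?lex1 ?leP ?geP ?le0x ?lex1.
move=> A; apply: (can_inj idealK); rewrite subspace_supK.
by rewrite -ortho_ideal subspace_supK.
Qed.

(** An order isomorphism commuting with orthocomplements is adjoint to its inverse. *)
Lemma adjoint_sup_ideal :
  @adjoint (orthoset_of (subspaces X)) X subspace_sup ideal.
Proof.
move=> A b; change ((subspace_sup A <= ortho b)%O <-> (A <= ortho (ideal b))%O).
by rewrite ortho_ideal -ideal_le subspace_supK.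
Qed.

Definition adj_sup : adjMap (orthoset_of (subspaces X)) X :=
  @AdjMap (orthoset_of (subspaces X)) X subspace_sup
    (ex_intro _ ideal adjoint_sup_ideal).

(** [star] is obtained by choice; uniqueness identifies it with [ideal], so the dagger isomorphism
    equations become the two cancellation laws. *)
Lemma star_adj_sup :
  star adj_sup =
  @AdjMap X (orthoset_of (subspaces X)) ideal
    (ex_intro _ subspace_sup (adjoint_sym adjoint_sup_ideal)).
Proof.
apply: star_uniq; [exact: irredundant_orthoset_of | exact: adjoint_sup_ideal].
Qed.

(** * Sasaki projections as adjoints of inclusions *)

Hypothesis omL : orthomodular L.

Definition sasaki a b : L := (a `&` (ortho a `|` b))%O.

Lemma adjoint_sasaki a x t :
  (t <= a)%O -> (t <= ortho (sasaki a x))%O = (t <= ortho x)%O.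
Proof.
move=> ta; rewrite /sasaki ortho_meet ortho_join orthoK.
apply/idP/idP => [tx|tx].
  have : (t <= a `&` (ortho a `|` (a `&` ortho x)))%O by rewrite lexI ta.
  (* Dual orthomodularity for [a /\ ortho x <= a] collapses the bound to [a /\ ortho x]. *)
  have /orthomodular_dual om := omL; rewrite -om ?leIl //.
  by rewrite lexI => /andP[].
by apply: (@le_trans _ _ (a `&` ortho x)%O); rewrite ?lexI ?ta // leUr.
Qed.

Lemma adjointable_incl_lattice (A : subspaces X) : adjointable (incl A).
Proof.
have Ap (x : X) : val A (sasaki (subspace_sup A) x).
  by apply/subspace_supE; exact: leIl.
exists (fun x => exist _ _ (Ap x)) => -[t At] x.
change ((t <= ortho (x : L))%O <-> (t <= ortho (sasaki (subspace_sup A) x))%O).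
by rewrite adjoint_sasaki //; apply/subspace_supE.
Qed.

(** Follows from the criterion on inclusions, without transport along [subspace_sup]. *)
Lemma dacey_lattice : dacey X.
Proof. exact/adjointable_incl_dacey/adjointable_incl_lattice. Qed.

End PrincipalIdeals.

Theorem theorem6p12 :
  (exists F : functor_on subspaces_coml,
     [/\ forall (X Y : iDS) (f : hom X Y) (A : subspaces_coml X),
           val (fmap F f A) = biperp (f @` val A),
         faithful F,
         dagger_essentially_surjective F
       & dagger_preserving F])
  /\
  (forall X : iOrthoset,
     (forall A : subspaces X, adjointable (incl A)) -> dacey X)
  /\
  (forall (d : Order.disp_t) (L : completeOrtholatticeType d),
     orthomodular L ->
     exists X : iOrthoset,
       (forall A : subspaces X, adjointable (incl A))
       /\ exists phi : subspaces X -> L, ortholattice_iso phi).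
Proof.
split; [exists subspaces_functor; split|split].
- by [].
- by move=> X Y f g; apply/adj_span_inj/iorthosetP.
(* The preimage of [L] is [L] itself viewed as an orthoset. *)
- move=> L; pose X : iDS := @IDacey (coml_orthoset L) (dacey_lattice (@comlP L)).
  exists X, (@adj_sup _ L).
  rewrite /dagger_iso [dagger _]star_adj_sup.
  by split; apply: adjMap_eq; [exact: subspace_supK | exact: idealK].
- by move=> X Y f; apply: star_adj_span.
- exact: adjointable_incl_dacey.
move=> d L omL; exists (@IOrthoset (orthoset_of L) irredundant_orthoset_of).
split; first exact: adjointable_incl_lattice.
by exists subspace_sup; apply: subspace_sup_iso.
Qed.
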